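(* Let $\mathsf{JL}$ be one of the justification logics described in the context, and let $\mathcal{CS}$ be a constant specification for $\mathsf{JL}$. If a $\mathsf{JL}$-formula $A$ has a $\mathsf{JL}^e_{\mathcal{CS}}$-tableau proof, then $A$ is $\mathsf{JL}_{\mathcal{CS}}$-valid.
   Context: **Language.** Justification terms are built from justification variables $x,y,z,\dots$ and justification constants $a,b,c,\dots$ using binary operations $\cdot$, $+$ and unary operations $!$, $\bar{?}$, $?$. Formulas are given by $A ::= p \mid \bot \mid \neg A \mid A\to A \mid t:A$, where $p$ ranges over a countable set $\mathcal{P}$ of propositional variables and $t$ over terms. Subterms are defined as usual. A term $t$ occurs in a formula $F$ if $t$ is a subterm of some $r$ such that $r:B$ is a subformula of $F$ for some $B$. $Sub(A)$ is the set of subformulas: $Sub(p)=\{p\}$, $Sub(\bot)=\{\bot\}$, $Sub(\neg A)=\{\neg A\}\cup Sub(A)$, $Sub(A\to B)=\{A\to B\}\cup Sub(A)\cup Sub(B)$, $Sub(t:A)=\{t:A\}\cup Sub(A)$; for a set $S$ of formulas, $Sub(S)=\bigcup_{A\in S}Sub(A)$. **Justification logics.** The basic logic $\mathsf{J}$ has axiom schemes: (Taut) all propositional tautologies; (Sum) $s:A\to(s+t):A$ and $s:A\to(t+s):A$; (jK) $s:(A\to B)\to(t:A\to(s\cdot t):B)$. $\mathsf{JL}$ denotes any logic obtained from $\mathsf{J}$ by adding any combination (possibly none) of: (jT) $t:A\to A$; (jD) $t:\bot\to\bot$; (j4) $t:A\to\,!t:t:A$; (jB) $\neg A\to\bar{?}t:\neg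 t:A$; (j5) $\neg t:A\to\,?t:\neg t:A$. The language of $\mathsf{JL}$ includes only those term operations present in its axioms; $Tm_{\mathsf{JL}}$ and $Fm_{\mathsf{JL}}$ are its sets of terms and formulas ($\mathsf{JL}$-formulas). **Constant specification.** A constant specification $\mathcal{CS}$ for $\mathsf{JL}$ is a set of formulas $c_{i_n}:c_{i_{n-1}}:\dots:c_{i_1}:A$, with $n\ge1$, the $c_{i_j}$ justification constants and $A$ an axiom instance of $\mathsf{JL}$, which is downward closed: if $c_{i_n}:c_{i_{n-1}}:\dots:c_{i_1}:A\in\mathcal{CS}$ with $n\ge2$, then $c_{i_{n-1}}:\dots:c_{i_1}:A\in\mathcal{CS}$. **Models and validity.** A $\mathsf{JL}_{\mathcal{CS}}$-model (Mkrtychev model, M-model) is a pair $\mathcal{M}=(\mathcal{E},\mathcal{V})$ with $\mathcal{V}:\mathcal{P}\to\{0,1\}$ and $\mathcal{E}:Tm_{\mathsf{JL}}\to2^{Fm_{\mathsf{JL}}}$. Truth: $\mathcal{M}\not\Vdash\bot$; $\mathcal{M}\Vdash p$ iff $\mathcal{V}(p)=1$; $\mathcal{M}\Vdash\neg A$ iff $\mathcal{M}\not\Vdash A$; $\mathcal{M}\Vdash A\to B$ iff $\mathcal{M}\not\Vdash A$ or $\mathcal{M}\Vdash B$; $\mathcal{M}\Vdash t:A$ iff $A\in\mathcal{E}(t)$. Required for all terms and formulas: ($\mathcal{E}1$) $A\to B\in\mathcal{E}(s)$ and $A\in\mathcal{E}(t)$ imply $B\in\mathcal{E}(s\cdot t)$;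 ($\mathcal{E}2$) $\mathcal{E}(s)\cup\mathcal{E}(t)\subseteq\mathcal{E}(s+t)$; ($\mathcal{E}3$) $c:F\in\mathcal{CS}$ implies $F\in\mathcal{E}(c)$; and additionally, if $\mathsf{JL}$ contains jT: $A\in\mathcal{E}(t)$ implies $\mathcal{M}\Vdash A$; if jD: $\bot\notin\mathcal{E}(t)$; if j4: $A\in\mathcal{E}(t)$ implies $t:A\in\mathcal{E}(!t)$; if jB: $\mathcal{M}\not\Vdash A$ implies $\neg t:A\in\mathcal{E}(\bar{?}t)$; if j5: $A\notin\mathcal{E}(t)$ implies $\neg t:A\in\mathcal{E}(?t)$. A $\mathsf{JL}$-formula is $\mathsf{JL}_{\mathcal{CS}}$-valid if it is true in every $\mathsf{JL}_{\mathcal{CS}}$-model. **Tableaux.** $A$ is a $\mathcal{CS}$-subformula of $B$ if $A\in Sub(\{B\}\cup\mathcal{CS})$. Tableaux use $\mathsf{JL}$-formulas and evidential formulas $[t,A]$ and $\sim[t,A]$, where $t$ is a term and $A$ a $\mathsf{JL}$-formula. A $\mathsf{JL}^e_{\mathcal{CS}}$-tableau for a formula $F$ is a binary tree with root $\neg F$ built by extending branches with the following rules (premises must be on the branch; ''$\mid$'' means the branch splits): - $(F\neg)$: from $\neg\neg A$ add $A$. $(F\to)$: from $\neg(A\to B)$ add $A$ and $\neg B$. $(T\to)$: from $A\to B$ split $\neg A\mid B$. - $(Te)$: from $t:A$ add $[t,A]$. $(Fe)$: from $\neg t:A$ add $\sim[t,A]$. - $(+_L)$: from $\sim[t+s,A]$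 add $\sim[t,A]$. $(+_R)$: from $\sim[t+s,A]$ add $\sim[s,A]$. - $(\cdot)$: from $[s,A\to B]$ and $[t,A]$ add $[s\cdot t,B]$, provided $A\to B$ is a $\mathcal{CS}$-subformula of the root and $s\cdot t$ occurs in the root. - $(PB)$: split $A\mid\neg A$, provided $A$ is a $\mathcal{CS}$-subformula of the root. - $(PB_e)$: split $[t,A]\mid\sim[t,A]$, provided $A$ is a $\mathcal{CS}$-subformula of the root and $t$ occurs in the root. - If $\mathsf{JL}$ contains jT, $(e)$: from $[t,A]$ add $A$. If jD, $(e_\bot)$: from $[t,\bot]$ add $\bot$. If j4, $(!)$: from $\sim[!t,t:A]$ add $\sim[t,A]$. If jB, $(\bar{?})$: from $\sim[\bar{?}t,\neg t:A]$ add $A$. If j5, $(?)$: from $\sim[?t,\neg t:A]$ add $[t,A]$. A branch closes if it contains $A$ and $\neg A$ for some $\mathsf{JL}$-formula $A$; or $[t,A]$ and $\sim[t,A]$ for some $t,A$; or $\bot$; or $\neg c:F$ for some $c:F\in\mathcal{CS}$. A tableau closes if all its branches close. A $\mathsf{JL}^e_{\mathcal{CS}}$-tableau proof of $F$ is a closed $\mathsf{JL}^e_{\mathcal{CS}}$-tableau with root $\neg F$. *)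

(* Defs.v *)
From Stdlib Require List.
From mathcomp Require Import all_boot.

Set Implicit Arguments.
Unset Strict Implicit.
Unset Printing Implicit Defensive.

(* A logic JL together with the symbols of its language: J plus any combination
   of the five optional axiom schemes. *)
Record logic := Logic {
  prop_var : countType;
  just_var : Type;
  just_const : Type;
  has_jT : bool;
  has_jD : bool;
  has_j4 : bool;
  has_jB : bool;
  has_j5 : bool }.

(* The operations !, ?-bar and ? take a (proof-irrelevant, boolean) proof that
   the corresponding axiom is present, so [tm L] and [fm L] are exactly the
   terms and formulas of the language of L. *)
Inductive tm (L : logic) : Type :=
| Var of just_var L
| Cst of just_const L
| App of tm L & tm L
| Plus of tm L & tm L
| Bang of has_j4 L & tm L
| BarQuest of has_jB L & tm L
| Quest of has_j5 L & tm L.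

Inductive fm (L : logic) : Type :=
| Atom of prop_var L
| Bot
| Neg of fm L
| Imp of fm L & fm L
| Just of tm L & fm L.
Arguments Bot {L}.

Fixpoint Subt (L : logic) (r t : tm L) : Prop :=
  t = r \/ match r with
           | Var _ | Cst _ => False
           | App r1 r2 | Plus r1 r2 => Subt r1 t \/ Subt r2 t
           | Bang _ r1 | BarQuest _ r1 | Quest _ r1 => Subt r1 t
           end.

(* [Sub A B]: B belongs to Sub(A). *)
Fixpoint Sub (L : logic) (A B : fm L) : Prop :=
  B = A \/ match A with
           | Atom _ | Bot => False
           | Neg A1 => Sub A1 B
           | Imp A1 A2 => Sub A1 B \/ Sub A2 B
           | Just _ A1 => Sub A1 B
           end.

Definition occurs (L : logic) (t : tm L) (F : fm L) : Prop :=
  exists r B, Sub F (Just r B) /\ Subt r t.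

(* Propositional evaluation, with the formulas t:A treated as atoms. *)
Fixpoint prop_eval (L : logic) (v : prop_var L -> bool)
    (w : tm L -> fm L -> bool) (A : fm L) : bool :=
  match A with
  | Atom p => v p
  | Bot => false
  | Neg A1 => ~~ prop_eval v w A1
  | Imp A1 A2 => prop_eval v w A1 ==> prop_eval v w A2
  | Just t A1 => w t A1
  end.

Definition tautology (L : logic) (A : fm L) : Prop :=
  forall v w, prop_eval v w A.

Inductive axiom (L : logic) : fm L -> Prop :=
| ax_taut A : tautology A -> axiom A
| ax_suml s t A : axiom (Imp (Just s A) (Just (Plus s t) A))
| ax_sumr s t A : axiom (Imp (Just s A) (Just (Plus t s) A))
| ax_jK s t A B :
    axiom (Imp (Just s (Imp A B)) (Imp (Just t A) (Just (App s t) B)))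
| ax_jT t A : has_jT L -> axiom (Imp (Just t A) A)
| ax_jD t : has_jD L -> axiom (Imp (Just t Bot) Bot)
| ax_j4 (h : has_j4 L) t A :
    axiom (Imp (Just t A) (Just (Bang h t) (Just t A)))
| ax_jB (h : has_jB L) t A :
    axiom (Imp (Neg A) (Just (BarQuest h t) (Neg (Just t A))))
| ax_j5 (h : has_j5 L) t A :
    axiom (Imp (Neg (Just t A)) (Just (Quest h t) (Neg (Just t A)))).

Definition const_chain (L : logic) (cs : seq (just_const L)) (A : fm L) : fm L :=
  foldr (fun c B => Just (Cst c) B) A cs.

Record const_spec (L : logic) (CS : fm L -> Prop) : Prop := ConstSpec {
  cs_form : forall F, CS F ->
    exists c cs A, axiom A /\ F = const_chain (c :: cs) A;
  cs_down : forall c d cs A, axiom A ->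
    CS (const_chain [:: c, d & cs] A) -> CS (const_chain (d :: cs) A) }.

Record premodel (L : logic) := Premodel {
  evid : tm L -> fm L -> Prop;
  pval : prop_var L -> bool }.

Fixpoint sat (L : logic) (M : premodel L) (A : fm L) : Prop :=
  match A with
  | Atom p => pval M p = true
  | Bot => False
  | Neg A1 => ~ sat M A1
  | Imp A1 A2 => ~ sat M A1 \/ sat M A2
  | Just t A1 => evid M t A1
  end.

Record is_model (L : logic) (CS : fm L -> Prop) (M : premodel L) : Prop := IsModel {
  evid_app : forall s t A B,
    evid M s (Imp A B) -> evid M t A -> evid M (App s t) B;
  evid_plus : forall s t A, evid M s A \/ evid M t A -> evid M (Plus s t) A;
  evid_cs : forall c F, CS (Just (Cst c) F) -> evid M (Cst c) F;
  evid_jT : has_jT L -> forall t A, evid M t A -> sat M A;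
  evid_jD : has_jD L -> forall t, ~ evid M t Bot;
  evid_j4 : forall (h : has_j4 L) t A,
    evid M t A -> evid M (Bang h t) (Just t A);
  evid_jB : forall (h : has_jB L) t A,
    ~ sat M A -> evid M (BarQuest h t) (Neg (Just t A));
  evid_j5 : forall (h : has_j5 L) t A,
    ~ evid M t A -> evid M (Quest h t) (Neg (Just t A)) }.

Definition valid (L : logic) (CS : fm L -> Prop) (A : fm L) : Prop :=
  forall M : premodel L, is_model CS M -> sat M A.

Definition cs_subformula (L : logic) (CS : fm L -> Prop) (A B : fm L) : Prop :=
  exists C, (C = B \/ CS C) /\ Sub C A.

(* [Ev t A] is [t,A] and [NEv t A] is ~[t,A]. *)
Inductive tfm (L : logic) : Type :=
| Fm of fm L
| Ev of tm L & fm L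
| NEv of tm L & fm L.

(* [ext_rule CS R b new]: on a branch containing the formulas in b, in a tableau
   with root R, a non-branching rule allows one to add the formulas in new. *)
Inductive ext_rule (L : logic) (CS : fm L -> Prop) (R : fm L)
    (b : seq (tfm L)) : seq (tfm L) -> Prop :=
| rule_Fneg A : List.In (Fm (Neg (Neg A))) b -> ext_rule CS R b [:: Fm A]
| rule_Fimp A B : List.In (Fm (Neg (Imp A B))) b ->
    ext_rule CS R b [:: Fm A; Fm (Neg B)]
| rule_Te t A : List.In (Fm (Just t A)) b -> ext_rule CS R b [:: Ev t A]
| rule_Fe t A : List.In (Fm (Neg (Just t A))) b -> ext_rule CS R b [:: NEv t A]
| rule_plusL t s A : List.In (NEv (Plus t s) A) b ->
    ext_rule CS R b [:: NEv t A]
| rule_plusR t s A : List.In (NEv (Plus t s) A) b ->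
    ext_rule CS R b [:: NEv s A]
| rule_app s t A B : List.In (Ev s (Imp A B)) b -> List.In (Ev t A) b ->
    cs_subformula CS (Imp A B) R -> occurs (App s t) R ->
    ext_rule CS R b [:: Ev (App s t) B]
| rule_jT t A : has_jT L -> List.In (Ev t A) b -> ext_rule CS R b [:: Fm A]
| rule_jD t : has_jD L -> List.In (Ev t Bot) b -> ext_rule CS R b [:: Fm Bot]
| rule_j4 (h : has_j4 L) t A : List.In (NEv (Bang h t) (Just t A)) b ->
    ext_rule CS R b [:: NEv t A]
| rule_jB (h : has_jB L) t A :
    List.In (NEv (BarQuest h t) (Neg (Just t A))) b ->
    ext_rule CS R b [:: Fm A]
| rule_j5 (h : has_j5 L) t A :
    List.In (NEv (Quest h t) (Neg (Just t A))) b ->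
    ext_rule CS R b [:: Ev t A].

Inductive split_rule (L : logic) (CS : fm L -> Prop) (R : fm L)
    (b : seq (tfm L)) : tfm L -> tfm L -> Prop :=
| rule_Timp A B : List.In (Fm (Imp A B)) b ->
    split_rule CS R b (Fm (Neg A)) (Fm B)
| rule_PB A : cs_subformula CS A R -> split_rule CS R b (Fm A) (Fm (Neg A))
| rule_PBe t A : cs_subformula CS A R -> occurs t R ->
    split_rule CS R b (Ev t A) (NEv t A).

(* The part of a tableau below its root: [Extend new T] puts the formulas of
   new one below the other, followed by T; [Split x T y T'] branches into a
   child x followed by T and a child y followed by T'. *)
Inductive tree (L : logic) : Type :=
| Leaf
| Extend of seq (tfm L) & tree L
| Split of tfm L & tree L & tfm L & tree L.
Arguments Leaf {L}.

(* [grows CS R b T]: T continues the branch b according to the rules. *)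
Inductive grows (L : logic) (CS : fm L -> Prop) (R : fm L) :
    seq (tfm L) -> tree L -> Prop :=
| grows_leaf b : grows CS R b Leaf
| grows_ext b new T :
    ext_rule CS R b new -> grows CS R (b ++ new) T ->
    grows CS R b (Extend new T)
| grows_split b x T y T' :
    split_rule CS R b x y ->
    grows CS R (rcons b x) T -> grows CS R (rcons b y) T' ->
    grows CS R b (Split x T y T').

Fixpoint branches (L : logic) (b : seq (tfm L)) (T : tree L) :
    seq (seq (tfm L)) :=
  match T with
  | Leaf => [:: b]
  | Extend new T1 => branches (b ++ new) T1
  | Split x T1 y T2 => branches (rcons b x) T1 ++ branches (rcons b y) T2
  end.

Inductive branch_closed (L : logic) (CS : fm L -> Prop) (b : seq (tfm L)) : Prop :=
| closed_fm A : List.In (Fm A) b -> List.In (Fm (Neg A)) b -> branch_closed CS b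
| closed_ev t A : List.In (Ev t A) b -> List.In (NEv t A) b -> branch_closed CS b
| closed_bot : List.In (Fm Bot) b -> branch_closed CS b
| closed_cs c F : CS (Just (Cst c) F) ->
    List.In (Fm (Neg (Just (Cst c) F))) b -> branch_closed CS b.

Definition tableau_root (L : logic) (F : fm L) : seq (tfm L) := [:: Fm (Neg F)].

Definition tableau (L : logic) (CS : fm L -> Prop) (F : fm L) (T : tree L) : Prop :=
  grows CS (Neg F) (tableau_root F) T.

Definition tableau_closed (L : logic) (CS : fm L -> Prop) (F : fm L)
    (T : tree L) : Prop :=
  forall b, List.In b (branches (tableau_root F) T) -> branch_closed CS b.

Definition tableau_provable (L : logic) (CS : fm L -> Prop) (F : fm L) : Prop :=
  exists T : tree L, tableau CS F T /\ tableau_closed CS F T.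

(* Main.v *)
(** If every formula on a branch holds in a model, then every rule has a
    conclusion that holds there too; so if the root [Neg A] holds in a model,
    some branch of the tableau is satisfied by it, and no satisfied branch is
    closed. *)
Require Import Defs.
From mathcomp Require Import all_boot.
From Stdlib Require Import Classical.

(** [Ev t A] gets the truth condition of [Just t A], and [NEv t A] that of its negation. *)
Definition tsat (L : logic) (M : premodel L) (x : tfm L) : Prop :=
  match x with
  | Fm A => sat M A
  | Ev t A => evid M t A
  | NEv t A => ~ evid M t A
  end.

Definition branch_sat (L : logic) (M : premodel L) (b : seq (tfm L)) : Prop :=
  forall x, List.In x b -> tsat L M x.

Lemma branch_sat_cat (L : logic) (M : premodel L) (b b' : seq (tfm L)) :
  branch_sat L M b -> branch_sat L M b' -> branch_sat L M (b ++ b').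
Proof.
move=> hb hb' x hx.
by have [/hb | /hb'] := List.in_app_or _ _ _ hx.
Qed.

Lemma branch_sat_rcons (L : logic) (M : premodel L) (b : seq (tfm L)) x :
  branch_sat L M b -> tsat L M x -> branch_sat L M (rcons b x).
Proof.
by move=> hb hx; rewrite -cats1; apply: branch_sat_cat => // y [<-|[]].
Qed.

(** Rules with an [Ev] premise apply a closure condition of [evid] directly; those with an [NEv]
    premise apply one contrapositively. *)
Lemma ext_rule_sound (L : logic) (CS : fm L -> Prop) (R : fm L)
    (M : premodel L) (b new : seq (tfm L)) :
  is_model CS M -> ext_rule CS R b new -> branch_sat L M b ->
  branch_sat L M new.
Proof.
move=> HM [].
- by move=> A /[swap] hb /hb /= /NNPP hA _ [<-|[]].
- move=> A B /[swap] hb /hb /= /not_or_and [/NNPP hA hB].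
  by move=> _ [<-|[<-|[]]].
- by move=> t A /[swap] hb /hb /= hA _ [<-|[]].
- by move=> t A /[swap] hb /hb /= hA _ [<-|[]].
- move=> t s A /[swap] hb /hb /= hA _ [<-|[]] /= ht.
  by apply: hA; apply: (evid_plus HM); left.
- move=> t s A /[swap] hb /hb /= hA _ [<-|[]] /= hs.
  by apply: hA; apply: (evid_plus HM); right.
- move=> s t A B hs ht _ _ hb _ [<-|[]] /=.
  exact: (evid_app HM (hb _ hs) (hb _ ht)).
- by move=> t A hT /[swap] hb /hb /= /(evid_jT HM hT) hA _ [<-|[]].
(* Here the premise itself fails in every model, so no satisfied branch admits the rule. *)
- by move=> t hD /[swap] hb /hb /= /(evid_jD HM hD).
- move=> h t A /[swap] hb /hb /= hA _ [<-|[]] /= ht.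
  by apply: hA; apply: (evid_j4 HM).
(* For jB and j5 the model condition starts from a negation, so the positive conclusion is reached
   by contradiction. *)
- move=> h t A /[swap] hb /hb /= hA _ [<-|[]] /=; apply: NNPP => hn.
  by apply: hA; apply: (evid_jB HM).
- move=> h t A /[swap] hb /hb /= hA _ [<-|[]] /=; apply: NNPP => hn.
  by apply: hA; apply: (evid_j5 HM).
Qed.

(** The split of an implication is its truth clause; the two cuts are excluded middle. *)
Lemma split_rule_sound (L : logic) (CS : fm L -> Prop) (R : fm L)
    (M : premodel L) (b : seq (tfm L)) (x y : tfm L) :
  split_rule CS R b x y -> branch_sat L M b -> tsat L M x \/ tsat L M y.
Proof.
case=> [A B /[swap] hb /hb // | A _ _ | t A _ _ _]; exact: classic.
Qed.

(** Induction on growth, with the branch varying: at a split, follow a child that holds in [M]. *)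
Lemma grows_sound (L : logic) (CS : fm L -> Prop) (R : fm L)
    (M : premodel L) (b : seq (tfm L)) (T : tree L) :
  is_model CS M -> grows CS R b T -> branch_sat L M b ->
  exists2 b', List.In b' (branches b T) & branch_sat L M b'.
Proof.
move=> HM; elim=> {b T} /=.
- by move=> b hb; exists b => //; left.
- move=> b new T hr _ IH hb; apply: IH; apply: branch_sat_cat => //.
  exact: ext_rule_sound HM hr hb.
- move=> b x T y T' hr _ IHx _ IHy hb.
  have [hx|hy] := split_rule_sound _ _ _ _ _ _ _ hr hb.
  + have [b' inb' hb'] := IHx (branch_sat_rcons _ _ _ _ hb hx).
    by exists b' => //; apply: List.in_or_app; left.
  + have [b' inb' hb'] := IHy (branch_sat_rcons _ _ _ _ hb hy).
    by exists b' => //; apply: List.in_or_app; right.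
Qed.

Lemma branch_sat_not_closed (L : logic) (CS : fm L -> Prop) (M : premodel L)
    (b : seq (tfm L)) :
  is_model CS M -> branch_sat L M b -> ~ branch_closed CS b.
Proof.
move=> HM hb [A /hb hA /hb | t A /hb hA /hb | /hb | c F hF /hb] //=.
(* Only closure by [CS] remains; the other three are immediate contradictions. *)
by apply; apply: (evid_cs HM).
Qed.

Theorem theorem3p1 (L : logic) (CS : fm L -> Prop) (hCS : const_spec CS)
    (A : fm L) (hA : tableau_provable CS A) : valid CS A.
Proof.
move=> M HM; apply: NNPP => hnA.
have [T [hT hclosed]] := hA.
(* A countermodel [M] of [A] satisfies the root. *)
have hroot : branch_sat L M (tableau_root A) by move=> _ [<-|[]].
have [b inb hb] := grows_sound _ _ _ _ _ _ HM hT hroot.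
exact: branch_sat_not_closed HM hb (hclosed b inb).
Qed.
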